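(* Let $K$ be a field, let $m\ge 1$ be an integer, and let $f(X,Y)=a_0+a_1Y+\cdots+a_mY^m$, with $a_0,a_1,\ldots,a_m\in K[X]$ and $a_0a_m\neq 0$. If $a_m=pq$ with $p,q\in K[X]$, $p$ irreducible over $K$, and $$\deg p>(m-1)\deg q+H_1(f),$$ then the polynomial $f(X,Y)$ is irreducible over $K(X)$.
   Context: For $f=a_0(X)+a_1(X)Y+\cdots+a_m(X)Y^m\in K[X,Y]$ with $a_m\ne 0$, $H_1(f)=\max\{\deg a_0,\ldots,\deg a_{m-1}\}$, where $\deg$ is the degree in $X$ (zero coefficients are ignored in the maximum, i.e. $\deg 0=-\infty$). ''Irreducible over $K(X)$'' means irreducible in the ring $K(X)[Y]$. *)

(* Defs.v *)
From mathcomp Require Import all_boot all_order all_algebra.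

Set Implicit Arguments.
Unset Strict Implicit.
Unset Printing Implicit Defensive.

Import GRing.Theory.
Local Open Scope ring_scope.

(* The inner indeterminate of {poly {poly K}} is X and the outer one is Y, so  *)
(* f`_i is the coefficient a_i(X) of Y^i.                                      *)

(* Degree as a natural number: a junk value 0 is assigned to deg 0.            *)
Definition deg (R : nzRingType) (p : {poly R}) : nat := (size p).-1.

(* max {deg a_0, ..., deg a_(m-1)} with m the degree of f in Y. Zero           *)
(* coefficients are skipped (deg 0 = -oo); if all of them vanish the value     *)
(* is 0 instead of -oo, a case excluded as soon as m >= 1 and a_0 != 0.        *)
Definition H1 (K : fieldType) (f : {poly {poly K}}) : nat :=
  (\max_(i < deg f | (f`_i != 0)%R) deg (f`_i)%R)%N.

(* The image in K(X)[Y] of f in K[X][Y].                                       *)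
Definition polyKX (K : fieldType) (f : {poly {poly K}}) :
    {poly {fraction {poly K}}} :=
  map_poly (@tofrac {poly K}) f.

(* Main.v *)
Require Import Defs.
From mathcomp Require Import all_boot all_order all_algebra.
From mathcomp Require Import zify.
From Stdlib Require Import Classical.

Set Implicit Arguments.
Unset Strict Implicit.
Unset Printing Implicit Defensive.

Import GRing.Theory.
Local Open Scope ring_scope.

(** Suppose that [f = G * H] over K(X) with both factors of positive degree in
    Y.  By Gauss's lemma the factors may be taken in K[X][Y], and then their
    leading coefficients multiply to [a_m = p * q].  As [p] is irreducible, it
    divides one of these leading coefficients; say that of [H], so that
    the leading coefficient [b] of [G] divides [q] and [deg b <= deg q].

    On the other hand, give X weight 1 and Y weight [- d], with [d = deg q].
    The hypothesis on [deg p] makes the weight of [a_m Y^m] larger than that of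
    every other term of [f], since [deg a_m - m * d = deg p - (m - 1) * d].
    Terms of extremal weight multiply ([coef_vertex_mul]), so this property
    passes to factors ([dominant_factor]): the leading term of [G], of Y-degree
    [s >= 1], outweighs its constant term [G_0].  The latter is nonzero because
    [a_0 != 0], hence [deg b > deg G_0 + s * d >= deg q], a contradiction.  In
    terms of roots: every root of [f] in an algebraic closure of K(X) has
    degree less than [- deg q], so a product of [s >= 1] of them is too small to
    become a nonzero polynomial when multiplied by [b].

    Gauss's lemma ([Gauss_factorization]) is obtained by clearing denominators
    and then removing the common denominator one irreducible factor at a
    time. *)

(** * Extremal terms of a product *)

(** The common engine of Gauss's lemma, where [P] is divisibility by a prime,
    and of the weight argument, where [P] says that the degree is small: if
    index [i] in [G] and index [j] in [H] are minimal among the significant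
    ones, then [G_i H_j] is the only significant contribution to the
    coefficient of index [i + j]. *)
Lemma coefM_isolate (R : nzRingType) (P : R -> Prop) (G H : {poly R})
    (i j : nat) :
  P 0 -> (forall x y, P x -> P y -> P (x + y)) ->
  (forall k l, (k + l = i + j)%N -> (k < i)%N || (l < j)%N ->
     P (G`_k * H`_l)) ->
  exists2 e, P e & (G * H)`_(i + j) = G`_i * H`_j + e.
Proof.
move=> P0 PD Pkl.
have lt_i : (i < (i + j).+1)%N by lia.
rewrite coefM (bigD1 (Ordinal lt_i)) //= addKn.
eexists; last by reflexivity.
apply: big_ind => // k; rewrite -val_eqE /= => neq_ki.
by have := ltn_ord k => lt_k; apply: Pkl; lia.
Qed.

(** * Gauss's lemma *)

Lemma irreducible_divisor (K : fieldType) (r : {poly K}) :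
  (1 < size r)%N -> exists2 s : {poly K}, irreducible_poly s & s %| r.
Proof.
elim: {r}(size r) {-2}r (leqnn (size r)) => [|n IHn] r le_rn r_gt1; first lia.
have r_neq0 : r != 0 by rewrite -size_poly_gt0; lia.
have [[s [s_neq1 s_r s_neqr]] | no_div] :=
  classic (exists s : {poly K}, [/\ size s != 1, s %| r & ~~ (s %= r)]).
  have s_neq0 : s != 0 by apply: contraNneq r_neq0 => s0; rewrite -dvd0p -s0.
  have lt_sr : (size s < size r)%N.
    by rewrite ltn_neqAle dvdp_size_eqp // s_neqr dvdp_leq.
  have s_gt1 : (1 < size s)%N by move: s_neq0; rewrite -size_poly_gt0; lia.
  have [||t irr_t t_s] := IHn s; [lia | lia |].
  by exists t => //; apply: dvdp_trans s_r.
exists r => //; split=> // s s_neq1 s_r.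
by apply: contra_notT no_div => s_neqr; exists s.
Qed.

Lemma irreducible_dvdpM (K : fieldType) (r g h : {poly K}) :
  irreducible_poly r -> (r %| g * h) = (r %| g) || (r %| h).
Proof.
move=> irr_r; have [r_g|r_ng] := boolP (r %| g); first by rewrite dvdp_mulr.
by rewrite Gauss_dvdpr // irreducible_poly_coprime.
Qed.

Lemma first_coef_not_dvdp (K : fieldType) (r : {poly K}) (G : {poly {poly K}}) :
  (forall k, r %| G`_k) \/
  (exists2 i, ~~ (r %| G`_i) & forall k, (k < i)%N -> r %| G`_k).
Proof.
have [all_r | /not_all_ex_not [i0 /negP ni0]] := classic (forall k, r %| G`_k).
  by left.
right; have ex_i : exists i, ~~ (r %| G`_i) by exists i0.
exists (ex_minn ex_i) => [|k]; case: ex_minnP => // i _ min_i lt_ki.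
by apply: contraLR lt_ki => /min_i; rewrite -leqNgt.
Qed.

(** The lowest coefficients not divisible by [r] in the two factors would
    produce a coefficient of the product not divisible by [r]. *)
Lemma irreducible_dvdp_coefM (K : fieldType) (r : {poly K})
    (G H : {poly {poly K}}) :
  irreducible_poly r -> (forall k, r %| (G * H)`_k) ->
  (forall k, r %| G`_k) \/ (forall k, r %| H`_k).
Proof.
move=> irr_r r_GH.
have [|[i r_nGi r_G]] := first_coef_not_dvdp r G; first by left.
have [|[j r_nHj r_H]] := first_coef_not_dvdp r H; first by right.
have [|||e r_e coefE] := @coefM_isolate _ (fun x => r %| x) G H i j.
- exact: dvdp0.
- by move=> x y r_x r_y; rewrite dvdp_addr.
- by move=> k l _ /orP[/r_G | /r_H]; [apply: dvdp_mulr | apply: dvdp_mull].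
have := r_GH (i + j)%N.
by rewrite coefE dvdp_addl // irreducible_dvdpM // (negPf r_nGi) (negPf r_nHj).
Qed.

Lemma dvdp_coef_scale (K : fieldType) (r : {poly K}) (G : {poly {poly K}}) :
  (forall k, r %| G`_k) -> exists G' : {poly {poly K}}, G = r *: G'.
Proof.
move=> r_G; exists (\poly_(k < size G) (G`_k %/ r)).
apply/polyP => k; rewrite coefZ coef_poly; case: ltnP => [_|le_Gk].
  by rewrite mulrC divpK.
by rewrite mulr0 nth_default.
Qed.

(** Each irreducible factor of [c] divides one of the two factors, from which
    it can be cancelled; this is a descent on the degree of [c]. *)
Lemma factorization_cancel_scalar (K : fieldType) (c : {poly K})
    (f G H : {poly {poly K}}) :
  c != 0 -> c *: f = G * H ->
  exists G' H' : {poly {poly K}},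
    [/\ f = G' * H', size G' = size G & size H' = size H].
Proof.
elim: {c}(size c) {-2}c (leqnn (size c)) G H => [|n IHn] c le_cn G H c_neq0 cfE.
  by move: c_neq0; rewrite -size_poly_gt0; lia.
have [le_c1 | c_gt1] := leqP (size c) 1.
  have /size_poly1P [a a_neq0 cE] : size c == 1.
    by move: c_neq0; rewrite -size_poly_gt0; lia.
  have a'_neq0 : (a^-1)%:P != 0 :> {poly K} by rewrite polyC_eq0 invr_eq0.
  exists ((a^-1)%:P *: G), H; split=> //; last by rewrite size_scale.
  by rewrite -scalerAl -cfE scalerA cE -polyCM mulVf // scale1r.
have [r irr_r r_c] := irreducible_divisor c_gt1.
have [c' cE] : exists c' : {poly K}, c = c' * r by apply/dvdpP.
have r_neq0 := irredp_neq0 irr_r.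
have c'_neq0 : c' != 0 by apply: contraNneq c_neq0; rewrite cE => ->; rewrite mul0r.
have le_c'n : (size c' <= n)%N.
  have r_gt1 : (1 < size r)%N := irr_r.1.
  have c'_gt0 : (0 < size c')%N by rewrite size_poly_gt0.
  have szc : size c = (size c' + size r).-1 by rewrite cE size_mul.
  by lia.
have cancel_r (F1 F2 : {poly {poly K}}) : r *: F1 = r *: F2 -> F1 = F2.
  by rewrite -!mul_polyC => /mulfI; apply; rewrite polyC_eq0.
have r_GH k : r %| (G * H)`_k by rewrite -cfE coefZ cE mulrAC dvdp_mull.
have [r_G|r_H] := irreducible_dvdp_coefM irr_r r_GH.
  have [G1 GE] := dvdp_coef_scale r_G.
  have [|G' [H' [fE szG szH]]] := IHn c' le_c'n G1 H c'_neq0.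
    by apply: cancel_r; rewrite scalerA mulrC -cE cfE GE scalerAl.
  by exists G', H'; rewrite GE size_scale.
have [H2 HE] := dvdp_coef_scale r_H.
have [|G' [H' [fE szG szH]]] := IHn c' le_c'n G H2 c'_neq0.
  by apply: cancel_r; rewrite scalerA mulrC -cE cfE HE scalerAr.
by exists G', H'; rewrite HE size_scale.
Qed.

Lemma fraction_denominator (R : idomainType) (x : {fraction R}) :
  exists2 d : R, d != 0 & exists n : R, tofrac d * x = tofrac n.
Proof.
elim/quotW: x => r; exists (\d_r); first exact: denom_ratioP.
exists (\n_r); unlock tofrac; rewrite -[LHS]FracField.pi_mul.
apply/eqmodP; rewrite /= FracField.equivfE /FracField.mulf.
by rewrite !numden_Ratio ?mulf_neq0 ?oner_neq0 ?denom_ratioP // !mul1r !mulr1.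
Qed.

Lemma poly_denominator (R : idomainType) (g : {poly {fraction R}}) :
  exists2 d : R, d != 0 &
    exists G : {poly R}, tofrac d *: g = map_poly (@tofrac R) G.
Proof.
elim/poly_ind: g => [|g x [d d_neq0 [G GE]]].
  by exists 1; [exact: oner_neq0 | exists 0; rewrite scaler0 rmorph0].
have [e e_neq0 [n nE]] := fraction_denominator x.
exists (d * e); first by rewrite mulf_neq0.
exists (e *: G * 'X + (d * n)%:P).
rewrite rmorphD !rmorphM /= map_polyX map_polyC map_polyZ -GE /=.
rewrite scalerDr -!scalerAl scalerA (mulrC (tofrac e)); congr (_ + _).
by rewrite map_polyC /= -mul_polyC -!polyCM -nE mulrA.
Qed.

Lemma Gauss_factorization (K : fieldType) (f : {poly {poly K}})
    (g h : {poly {fraction {poly K}}}) :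
  polyKX f = g * h ->
  exists G H : {poly {poly K}},
    [/\ f = G * H, size G = size g & size H = size h].
Proof.
move=> fE.
have [d d_neq0 [G GE]] := poly_denominator g.
have [e e_neq0 [H HE]] := poly_denominator h.
have tofrac_inj : injective (@tofrac {poly K}).
  by move=> x y /eqP; rewrite tofrac_eq => /eqP.
have size_lift (c : {poly K}) (k : {poly {fraction {poly K}}}) (F : {poly {poly K}}) :
    c != 0 -> tofrac c *: k = map_poly (@tofrac {poly K}) F -> size F = size k.
  move=> c_neq0 cE; rewrite -(size_map_inj_poly tofrac_inj (rmorph0 _) F) -cE.
  by rewrite size_scale // tofrac_eq0.
have deGH : (d * e) *: f = G * H.
  apply: (map_inj_poly tofrac_inj (rmorph0 _)).
  rewrite map_polyZ !rmorphM /= -GE -HE -scalerAl -scalerAr scalerA.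
  by rewrite -[map_poly _ f]/(polyKX f) fE.
have de_neq0 : d * e != 0 by rewrite mulf_neq0.
have [G' [H' [-> szG szH]]] := factorization_cancel_scalar de_neq0 deGH.
by exists G', H'; rewrite szG szH (size_lift d g) // (size_lift e h).
Qed.

(** * The weight argument *)

(** In the Newton polygon of the points [(k, w k)] with [S k], this is the left
    end of the edge of slope [d], that is the leftmost point at which
    [w k - d * k] is maximal; the products are arranged so as to stay in the
    natural numbers. *)
Definition newton_vertex (d : nat) (S : pred nat) (w : nat -> nat) (i : nat) :
    Prop :=
  S i /\ forall k, S k ->
    (w k + d * i <= w i + d * k)%N /\ ((k < i)%N -> (w k + d * i < w i + d * k)%N).

Lemma newton_vertex_exists (d n : nat) (S : pred nat) (w : nat -> nat) (i0 : nat) :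
  S i0 -> (forall k, S k -> (k < n)%N) -> exists i, newton_vertex d S w i.
Proof.
move=> Si0 lt_Sn.
pose wt k := (w k + d * (n - k))%N.
(* Lexicographic order on (weight, - index), as a single natural number. *)
pose key k := (wt k * n.+1 + (n - k))%N.
pose P := [pred i : 'I_n | S i].
case: (@arg_maxnP _ (Ordinal (lt_Sn i0 Si0)) P key Si0) => i /= Si max_i.
exists i; split=> // k Sk.
have lt_kn := lt_Sn k Sk; have lt_in := ltn_ord i.
have le_key : (key k <= key i)%N := max_i (Ordinal lt_kn) Sk.
have wtE j : (j < n)%N -> (wt j + d * j = w j + d * n)%N.
  by move=> lt_jn; rewrite /wt -addnA -mulnDr subnK // ltnW.
have le_wt : (wt k <= wt i)%N by move: le_key; rewrite /key; nia.
have lt_wt : (k < i)%N -> (wt k < wt i)%N by move: le_key; rewrite /key; nia.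
by move: (wtE k lt_kn) (wtE i lt_in) le_wt lt_wt; clearbody wt; lia.
Qed.

Definition coef_deg (K : fieldType) (g : {poly {poly K}}) (k : nat) : nat :=
  deg g`_k.

Definition coef_vertex (K : fieldType) (d : nat) (g : {poly {poly K}})
    (i : nat) : Prop :=
  newton_vertex d (fun k => g`_k != 0) (coef_deg g) i.

Lemma coef_neq0_leq_deg (R : nzRingType) (g : {poly R}) (k : nat) :
  g`_k != 0 -> (k <= deg g)%N.
Proof.
by apply: contraNleq; rewrite /deg => lt_k; rewrite nth_default //; case: size lt_k.
Qed.

Lemma coef_vertex_exists (K : fieldType) (d : nat) (g : {poly {poly K}}) :
  g != 0 -> exists i, coef_vertex d g i.
Proof.
move=> g_neq0; apply: (@newton_vertex_exists d (deg g).+1 _ _ (deg g)).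
  by rewrite -[_`_(deg g)]/(lead_coef g) lead_coef_eq0.
exact: coef_neq0_leq_deg.
Qed.

Lemma deg_mul (K : fieldType) (g h : {poly K}) :
  g != 0 -> h != 0 -> deg (g * h) = (deg g + deg h)%N.
Proof.
move=> g_neq0 h_neq0; have := size_mul g_neq0 h_neq0; rewrite /deg => ->.
by move: g_neq0 h_neq0; rewrite -!size_poly_gt0; case: (size g); case: (size h); lia.
Qed.

Lemma coef_vertex_mul (K : fieldType) (d : nat) (G H : {poly {poly K}})
    (i j : nat) :
  coef_vertex d G i -> coef_vertex d H j ->
  (G * H)`_(i + j) != 0 /\
  coef_deg (G * H) (i + j) = (coef_deg G i + coef_deg H j)%N.
Proof.
move=> [Gi_neq0 vG] [Hj_neq0 vH].
have GiHj_neq0 : G`_i * H`_j != 0 by rewrite mulf_neq0.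
pose small (x : {poly K}) := (size x < size (G`_i * H`_j)%R)%N.
have [|||e e_small coefE] := @coefM_isolate _ small G H i j.
- by rewrite /small size_poly0 size_poly_gt0.
- move=> x y; rewrite /small => lt_x lt_y.
  by apply: leq_ltn_trans (size_polyD x y) _; rewrite gtn_max lt_x.
- move=> k l klE lt_kl; rewrite /small.
  have [->|Gk_neq0] := eqVneq G`_k 0.
    by rewrite mul0r size_poly0 size_poly_gt0.
  have [->|Hl_neq0] := eqVneq H`_l 0.
    by rewrite mulr0 size_poly0 size_poly_gt0.
  have [leG ltG] := vG k Gk_neq0; have [leH ltH] := vH l Hl_neq0.
  have dE : (d * k + d * l = d * i + d * j)%N by rewrite -!mulnDr klE.
  have lt_deg : (coef_deg G k + coef_deg H l < coef_deg G i + coef_deg H j)%N.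
    by case/orP: lt_kl => [/ltG | /ltH]; lia.
  have := lt_deg; rewrite /coef_deg -!deg_mul // /deg.
  by rewrite -ltnS !prednK ?size_poly_gt0 ?mulf_neq0.
have size_coef : size (G * H)`_(i + j) = size (G`_i * H`_j).
  by rewrite coefE size_polyDl.
split; first by rewrite -size_poly_gt0 size_coef size_poly_gt0.
by rewrite /coef_deg -deg_mul // /deg size_coef.
Qed.

(** With Y of weight [- d]: the leading term in Y outweighs all the others. *)
Definition lead_dominant (K : fieldType) (d : nat) (g : {poly {poly K}}) : Prop :=
  forall k, (k < deg g)%N -> g`_k != 0 ->
    (coef_deg g k + d * deg g < coef_deg g (deg g) + d * k)%N.

(** The vertices [i] of [G] and [j] of [H] add up to a term of [G * H] at least
    as heavy as the leading one.  So [i + j] is the degree of [G * H], which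
    forces [i] and [j] to be the degrees of [G] and [H]. *)
Lemma dominant_factor (K : fieldType) (d : nat) (G H : {poly {poly K}}) :
  G * H != 0 -> lead_dominant d (G * H) -> lead_dominant d G.
Proof.
rewrite mulf_eq0 => /norP [G_neq0 H_neq0] dom.
have [i vGi] := coef_vertex_exists d G_neq0.
have [j vHj] := coef_vertex_exists d H_neq0.
have [ij_neq0 degij] := coef_vertex_mul vGi vHj.
have [Gi_neq0 vG] := vGi; have [Hj_neq0 vH] := vHj.
have leG := coef_neq0_leq_deg Gi_neq0; have leH := coef_neq0_leq_deg Hj_neq0.
have Gs_neq0 : G`_(deg G) != 0.
  by rewrite -[_`_(deg G)]/(lead_coef G) lead_coef_eq0.
have Ht_neq0 : H`_(deg H) != 0.
  by rewrite -[_`_(deg H)]/(lead_coef H) lead_coef_eq0.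
have [leGs _] := vG _ Gs_neq0; have [leHt _] := vH _ Ht_neq0.
have degGH : deg (G * H) = (deg G + deg H)%N.
  rewrite /deg size_mul //; move: G_neq0 H_neq0; rewrite -!size_poly_gt0.
  by case: (size G) => // s _; case: (size H) => // t _; rewrite addSn addnS.
have leadGH : coef_deg (G * H) (deg (G * H)) =
    (coef_deg G (deg G) + coef_deg H (deg H))%N.
  rewrite /coef_deg -deg_mul // -[_`_(deg (G * H))]/(lead_coef (G * H)).
  by rewrite lead_coefM.
have iE : i = deg G.
  apply/eqP; rewrite eqn_leq leG leqNgt; apply/negP => lt_iG.
  have lt_ij : (i + j < deg (G * H))%N by rewrite degGH -addSn leq_add.
  have := dom _ lt_ij ij_neq0.
  by rewrite degij leadGH degGH !mulnDr; lia.
by move=> k lt_kG Gk_neq0; have [_] := vG k Gk_neq0; rewrite iE; apply.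
Qed.

(** The constant term of [G], which has weight at least 0, is outweighed by the
    leading term, of weight [deg (lead_coef G) - d * deg G]. *)
Lemma dominant_factor_deg_gt (K : fieldType) (d : nat) (G H : {poly {poly K}}) :
  (G * H)`_0 != 0 -> lead_dominant d (G * H) ->
  (1 < size G)%N -> (d < deg (lead_coef G))%N.
Proof.
move=> GH0_neq0 dom G_gt1.
have GH_neq0 : G * H != 0 by apply: contraNneq GH0_neq0 => ->; rewrite coef0.
have G0_neq0 : G`_0 != 0.
  by apply: contraNneq GH0_neq0; rewrite coef0M => ->; rewrite mul0r.
have degG_gt0 : (0 < deg G)%N by rewrite /deg -ltnS prednK // ltnW.
have := dominant_factor GH_neq0 dom degG_gt0 G0_neq0.
rewrite -[coef_deg G (deg G)]/(deg (lead_coef G)) muln0 addn0.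
apply: leq_ltn_trans; apply: leq_trans (leq_addl _ _).
by rewrite -{1}[d]muln1 leq_mul2l degG_gt0 orbT.
Qed.

(** * The irreducibility criterion *)

Lemma cofactor_deg_leq (K : fieldType) (p q b c : {poly K}) :
  p * q != 0 -> b * c = p * q -> p %| c -> (deg b <= deg q)%N.
Proof.
move=> pq_neq0 bcE p_c.
have [c' cE] : exists c' : {poly K}, c = c' * p by apply/dvdpP.
have p_neq0 : p != 0 by apply: contraNneq pq_neq0 => ->; rewrite mul0r.
have q_neq0 : q != 0 by apply: contraNneq pq_neq0 => ->; rewrite mulr0.
have qE : q = b * c' by apply: (mulfI p_neq0); rewrite -bcE cE mulrA mulrC.
have b_q : b %| q by rewrite qE dvdp_mulr.
by rewrite /deg -!subn1 leq_sub2r // dvdp_leq.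
Qed.

Theorem corollary2 (K : fieldType) (m : nat) (f : {poly {poly K}})
    (p q : {poly K}) :
  (1 <= m)%N ->
  size f = m.+1 ->
  f`_0 * f`_m != 0 ->
  f`_m = p * q ->
  irreducible_poly p ->
  ((m - 1) * deg q + H1 f < deg p)%N ->
  irreducible_poly (polyKX f).
Proof.
move=> m_gt0 szf f0fm_neq0 fmE irr_p lt_p.
have [f0_neq0 fm_neq0] : f`_0 != 0 /\ f`_m != 0.
  by apply/andP; rewrite -negb_or -mulf_eq0.
have pq_neq0 : p * q != 0 by rewrite -fmE.
have [p_neq0 q_neq0] : p != 0 /\ q != 0.
  by apply/andP; rewrite -negb_or -mulf_eq0.
have degf : deg f = m by rewrite /deg szf.
have dom : lead_dominant (deg q) f.
  move=> k lt_k fk_neq0.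
  have le_H1 : (coef_deg f k <= H1 f)%N.
    exact: (@leq_bigmax_cond _ (fun i : 'I_(deg f) => f`_i != 0)
              (fun i => deg f`_i) (Ordinal lt_k) fk_neq0).
  have -> : coef_deg f (deg f) = (deg p + deg q)%N.
    by rewrite /coef_deg degf fmE deg_mul.
  by rewrite degf; nia.
have szF : size (polyKX f) = m.+1.
  rewrite -szf; apply: size_map_inj_poly; last exact: rmorph0.
  by move=> x y /eqP; rewrite tofrac_eq => /eqP.
split=> [|g g_neq1 g_F]; first by rewrite szF.
have F_neq0 : polyKX f != 0 by rewrite -size_poly_gt0 szF.
rewrite -dvdp_size_eqp //.
have [h FE] : exists h : {poly {fraction {poly K}}}, polyKX f = h * g.
  exact/dvdpP.
have [h_neq0 g_neq0] : h != 0 /\ g != 0.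
  by apply/andP; rewrite -negb_or -mulf_eq0 -FE.
have [H [G [fE szH szG]]] := Gauss_factorization FE.
have G_gt1 : (1 < size G)%N.
  by move: g_neq0 g_neq1; rewrite szG -size_poly_gt0; case: (size g) => [|[]].
have [H_gt1 | H_le1] := ltnP 1 (size H); last first.
  have /eqP h_eq1 : size h == 1 by rewrite eqn_leq -szH H_le1 szH size_poly_gt0.
  by rewrite FE size_mul // h_eq1.
have lead_HG : lead_coef H * lead_coef G = p * q.
  by rewrite -lead_coefM -fE lead_coefE szf.
rewrite fE in f0_neq0 dom.
have gt_H := dominant_factor_deg_gt f0_neq0 dom H_gt1.
rewrite mulrC in f0_neq0 dom.
have gt_G := dominant_factor_deg_gt f0_neq0 dom G_gt1.
have : p %| lead_coef H * lead_coef G by rewrite lead_HG dvdp_mulr.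
rewrite irreducible_dvdpM // => /orP[p_H | p_G].
  rewrite mulrC in lead_HG.
  by move: gt_G; rewrite ltnNge (cofactor_deg_leq pq_neq0 lead_HG p_H).
by move: gt_H; rewrite ltnNge (cofactor_deg_leq pq_neq0 lead_HG p_G).
Qed.
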